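(* For every odd integer $n\ge 5$, $\lambda_{2,n}(1)=1$ and $\lambda_{2,n}(2)=3$.
   Context: For an odd integer $n>1$, a representation of a positive integer $k$ (with respect to $2$ and $n$) is an expression $k=\sum_{j\ge 0}\varepsilon_j(2)2^j+\sum_{j\ge 0}\varepsilon_j(n)n^j$ with only finitely many nonzero coefficients, where $\varepsilon_j(2)\in\{0,\pm1\}$ and $\varepsilon_j(n)\in\{0,\pm1,\dots,\pm\lfloor n/2\rfloor\}$ are integers. Its length is $\sum_{j\ge 0}(|\varepsilon_j(2)|+|\varepsilon_j(n)|)$. For a positive integer $h$, $\lambda_{2,n}(h)$ denotes the smallest positive integer that has a representation of length $h$ but no representation of length less than $h$. *)

(* Defs.v *)
From HB Require Import structures.
From mathcomp Require Import all_boot all_order all_algebra.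
From mathcomp Require Import finmap.
Set Implicit Arguments.
Unset Strict Implicit.
Unset Printing Implicit Defensive.
Import Order.TTheory GRing.Theory Num.Theory.
Local Open Scope ring_scope.

(* A coefficient sequence (eps_j)_{j >= 0} of integers with only finitely many
   nonzero terms. *)
Definition coeffs : Type := {fsfun nat -> int with 0}.

(* Coefficients allowed in base b are 0, +-1, ..., +-floor(b/2); for b = 2 this
   is {0, +-1}. *)
Definition admissible (b : nat) (e : coeffs) : Prop :=
  forall j : nat, (`|e j| <= b %/ 2)%N.

(* The sums over j >= 0 run over the support, where all nonzero terms lie. *)
Definition coeffs_value (b : nat) (e : coeffs) : int :=
  \sum_(j <- finsupp e) e j * b%:Z ^+ j.

Definition coeffs_length (e : coeffs) : nat :=
  (\sum_(j <- finsupp e) `|e j|)%N.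

Definition has_repr_of_length (n k h : nat) : Prop :=
  exists e2 en : coeffs,
    [/\ admissible 2 e2, admissible n en,
        k%:Z = coeffs_value 2 e2 + coeffs_value n en
      & h = (coeffs_length e2 + coeffs_length en)%N].

Definition has_min_length (n k h : nat) : Prop :=
  has_repr_of_length n k h /\
  forall l : nat, (l < h)%N -> ~ has_repr_of_length n k l.

(* lambda_{2,n}(h) = m, as a relation: whether some k has minimal length h is
   part of the assertion and is not built into the definition. *)
Definition is_lambda2 (n h m : nat) : Prop :=
  [/\ (0 < m)%N, has_min_length n m h
    & forall k : nat, (0 < k)%N -> has_min_length n k h -> (m <= k)%N].

(* Main.v *)
Require Import Defs.
From mathcomp Require Import all_boot all_order all_algebra.
From mathcomp Require Import finmap zify.

Import GRing.Theory.

(** A representation of length 0 has value 0, and one of length 1 has a single nonzero coefficient,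
    equal to 1 or -1, so a positive integer represented this way is a power of 2 or of n
    ([repr_of_length1]). Hence 1 = 2^0 and 2 = 2^1 have minimal length 1. The integer 3 = 2^0 + 2^1
    has length 2 and no less, since it is not a power of 2, nor of n when n is at least 5
    ([expn_neq3]). *)

(** All witnesses needed are sums of distinct powers of 2, so 0/1 sequences given by their support
    suffice. *)
Definition indicator_coeffs (A : {fset nat}) : coeffs :=
  [fsfun j in A => 1%R : int].

Lemma indicator_coeffsE A j :
  indicator_coeffs A j = (if j \in A then 1 else 0)%R.
Proof. by rewrite fsfunE. Qed.

Lemma finsupp_indicator A : finsupp (indicator_coeffs A) = A.
Proof.
by apply/fsetP => j; rewrite mem_finsupp indicator_coeffsE; case: (j \in A).
Qed.

Lemma coeffs_value_indicator b A :
  coeffs_value b (indicator_coeffs A) = (\sum_(j <- A) b%:Z ^+ j)%R.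
Proof.
rewrite /coeffs_value finsupp_indicator big_seq [RHS]big_seq.
by apply: eq_bigr => j jA; rewrite indicator_coeffsE jA mul1r.
Qed.

Lemma coeffs_length_indicator A : coeffs_length (indicator_coeffs A) = #|` A|.
Proof.
rewrite /coeffs_length finsupp_indicator -sum1_size big_seq [RHS]big_seq.
by apply: eq_bigr => j jA; rewrite indicator_coeffsE jA.
Qed.

Lemma admissible_indicator b A : 1 < b -> admissible b (indicator_coeffs A).
Proof.
move=> b_gt1 j; rewrite indicator_coeffsE.
by case: ifP => // _; rewrite divn_gt0.
Qed.

Lemma has_repr_sum_pow2 n (A : {fset nat}) k : 1 < n ->
  (k%:Z = \sum_(j <- A) 2%:Z ^+ j)%R -> has_repr_of_length n k #|` A|.
Proof.
move=> n_gt1 kE; exists (indicator_coeffs A), (indicator_coeffs fset0).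
split; [exact: admissible_indicator | exact: admissible_indicator | |].
- by rewrite !coeffs_value_indicator big_seq_fset0 addr0.
- by rewrite !coeffs_length_indicator cardfs0 addn0.
Qed.

(** Each nonzero integer coefficient contributes at least 1 to the length. *)
Lemma card_finsupp_le_length e : #|` finsupp e| <= coeffs_length e.
Proof.
rewrite /coeffs_length -sum1_size big_seq [X in _ <= X]big_seq.
by apply: leq_sum => j; rewrite mem_finsupp absz_gt0.
Qed.

Lemma coeffs_length0_value b e : coeffs_length e = 0 -> coeffs_value b e = 0%R.
Proof.
move=> e0; have := card_finsupp_le_length e.
rewrite e0 leqn0 cardfs_eq0 => /eqP supp0.
by rewrite /coeffs_value supp0 big_seq_fset0.
Qed.

(** The support is a single index, with coefficient 1 or -1; the absolute value discards this
    sign. *)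
Lemma coeffs_length1_value b e : coeffs_length e = 1 ->
  exists j, `|coeffs_value b e|%N = b ^ j.
Proof.
move=> e1; have := card_finsupp_le_length e; rewrite e1; move: e1.
rewrite /coeffs_length /coeffs_value.
(* An empty support would give length 0, and two or more indices would exceed the bound on the
   support. *)
case: (enum_fset (finsupp e)) => [|j [|i s]] //=; first by rewrite big_nil.
by rewrite !big_seq1 => ej _; exists j; rewrite abszM abszX ej mul1n.
Qed.

Lemma no_repr_of_length0 n k : 0 < k -> ~ has_repr_of_length n k 0.
Proof.
move=> k_gt0 [e2 [en [_ _ kE hE]]].
have [e2_0 en_0] : coeffs_length e2 = 0 /\ coeffs_length en = 0 by lia.
by move: kE; rewrite !coeffs_length0_value //; lia.
Qed.

(** One of the two sequences has length 0 and contributes nothing, so the other carries the whole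
    value. *)
Lemma repr_of_length1 n k : has_repr_of_length n k 1 ->
  exists j, k = 2 ^ j \/ k = n ^ j.
Proof.
move=> [e2 [en [_ _ kE hE]]].
have [[h2 hn] | [h2 hn]] : (coeffs_length e2 = 1 /\ coeffs_length en = 0) \/
    (coeffs_length e2 = 0 /\ coeffs_length en = 1) by lia.
- have [j ej] := coeffs_length1_value 2 _ h2; exists j; left.
  (* Reading [k] as the absolute value of its image in the integers absorbs the unknown sign. *)
  by rewrite -ej -[k]/(`|k%:Z%R|%N) kE (coeffs_length0_value n _ hn) addr0.
- have [j ej] := coeffs_length1_value n _ hn; exists j; right.
  by rewrite -ej -[k]/(`|k%:Z%R|%N) kE (coeffs_length0_value 2 _ h2) add0r.
Qed.

(** Exponent 0 gives 1; any other power is a multiple of [b], and [b] does not divide 3. *)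
Lemma expn_neq3 b j : b = 2 \/ 3 < b -> b ^ j <> 3.
Proof.
by move=> b_neq; case: j => [|[|j]]; rewrite ?expn0 ?expn1 ?expnS; lia.
Qed.

Lemma has_repr_pow2 n j : 1 < n -> has_repr_of_length n (2 ^ j) 1.
Proof.
move=> n_gt1; rewrite -[X in has_repr_of_length _ _ X](cardfs1 j); apply: has_repr_sum_pow2 => //.
by rewrite big_seq_fset1 -[LHS]natz natrX natz.
Qed.

Theorem proposition3 (n : nat) (n_odd : odd n) (n_ge5 : 5 <= n) :
  is_lambda2 n 1 1 /\ is_lambda2 n 2 3.
Proof.
have n_gt1 : 1 < n by lia.
split; split=> //.
- split; first exact: (has_repr_pow2 _ 0).
  by case=> // _; exact: no_repr_of_length0.
- split.
    (* The length 2 is recast as the size of the exponent set of 3 = 2^0 + 2^1. *)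
    have -> : has_repr_of_length n 3 2 =
        has_repr_of_length n 3 #|` [fset 0; 1]%fset| by rewrite cardfs2.
    apply: has_repr_sum_pow2 => //.
    by rewrite big_fsetU1 ?inE // big_seq_fset1.
  case=> [_|[_|//]]; first exact: no_repr_of_length0.
  by case/repr_of_length1 => j [] /esym; apply: expn_neq3; lia.
(* Only 1 and 2 lie below 3, and both already have a representation of length 1. *)
- move=> [|[|[|k]]] // _ [_ /(_ 1 isT)] [].
    exact: (has_repr_pow2 _ 0).
  exact: (has_repr_pow2 _ 1).
Qed.
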